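(* Let $\phi(x)\equiv f(x)+g(Ax)$ satisfy the standing assumptions (S1) and (S2) given in the context, let $\alpha>0$ and $r\ge3$, and let $X$ be a solution on $\mathcal I=[0,T]\subset\mathbb{R}_+$ of the differential inclusion $$\alpha^{-1}A^TA\Big[\ddot X(t)+\frac{r}{t+1}\dot X(t)\Big]\in-\partial\phi(X(t)),\qquad X(0)=x_0\in\operatorname{dom}\phi,\quad\dot X(0)=0 .$$ If $\phi$ is convex, then there is a constant $C>0$ such that for almost all $t\in\mathcal I$ $$\phi(X(t))-\phi^\star\le\frac{C}{(t+1)^2}.$$ If $\phi$ is $\mu$-strongly convex, then there exist $t_0>0$ and a constant $C\ge0$ such that for almost all $t\in\mathcal I$ with $t\ge\max\{0,t_0\}$ $$\|X(t)-x^\star\|^2\le\frac{4C}{\alpha\mu\,(t+1)^{2r/3}} .$$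
   Context: Here $f:\mathbb{R}^n\to\mathbb{R}\cup\{+\infty\}$, $g:\mathbb{R}^m\to\mathbb{R}\cup\{+\infty\}$, $A\in\mathbb{R}^{m\times n}$. For a function $h$ with $\operatorname{dom}h=\{x:h(x)<\infty\}$, $\partial h(x)=\{v: h(y)-h(x)\ge\langle v,y-x\rangle\ \forall y\in\operatorname{dom}h\}$ for $x\in\operatorname{dom}h$. The function $h$ is $\mu$-strongly convex ($\mu>0$) if $h(y)\ge h(x)+\langle v,y-x\rangle+(\mu/2)\|y-x\|^2$ for all $x,y\in\operatorname{dom}h$ and all $v\in\partial h(x)$; it is convex if this holds with $\mu=0$. $\phi^\star=\min_x\phi(x)$ and $x^\star$ is a minimizer of $\phi$. Constants are independent of $t$. Standing assumptions. (S1) $f$ and $g$ are closed (closed epigraph) and convex, and $\phi$ has a finite global minimum; $A$ has full column rank. The paper takes this to include that $f,g$ are proper and lower semicontinuous and $0\in\operatorname{int}(\operatorname{dom}g-A\operatorname{dom}f)$, so that $\partial\phi(x)=\partial f(x)+A^T\partial g(Ax)$. (S2) There are constants $c>0$, $L>0$ such that every $\xi\in\partial\phi(x)$ satisfies $\|\xi\|\le c(1+\|x\|)$, and $\langle\xi_y-\xi_x,y-x\rangle\le L\|y-x\|^2$ for all $x,y$ and all $\xi_x\in\partial\phi(x)$, $\xi_y\in\partial\phi(y)$. A solution of a second-order differential inclusion is understood through its first-order form: $X$ and $\dot X$ are absolutely continuous on $\mathcal I$ and the inclusion holds for almost all $t\in\mathcal I$. *)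

(* Defs.v *)
From HB Require Import structures.
From mathcomp Require Import all_boot all_order all_algebra.
From mathcomp Require Import all_classical all_reals all_analysis.

Set Implicit Arguments.
Unset Strict Implicit.
Unset Printing Implicit Defensive.
Import Order.TTheory GRing.Theory Num.Theory.
Import numFieldNormedType.Exports.
Local Open Scope classical_set_scope.
Local Open Scope ring_scope.

(* The library norm on matrices is the sup norm, hence the explicit Euclidean
   inner product and norm. *)
Definition dotv (R : realType) (n : nat) (u v : 'cV[R]_n) : R :=
  \sum_(i < n) u i 0 * v i 0.

Definition enorm (R : realType) (n : nat) (u : 'cV[R]_n) : R :=
  Num.sqrt (dotv u u).

Definition edom (R : realType) (n : nat) (h : 'cV[R]_n -> \bar R) :
    set 'cV[R]_n :=
  [set x | (h x < +oo)%E].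

Definition subdiff (R : realType) (n : nat) (h : 'cV[R]_n -> \bar R)
    (x : 'cV[R]_n) : set 'cV[R]_n :=
  [set v | edom h x /\
    forall y, edom h y -> ((dotv v (y - x))%:E <= h y - h x)%E].

Definition strong_convexity_ineq (R : realType) (n : nat) (mu : R)
    (h : 'cV[R]_n -> \bar R) : Prop :=
  forall x y v, edom h x -> edom h y -> subdiff h x v ->
    (h x + (dotv v (y - x) + mu / 2 * enorm (y - x) ^+ 2)%:E <= h y)%E.

Definition strongly_convex (R : realType) (n : nat) (mu : R)
    (h : 'cV[R]_n -> \bar R) : Prop :=
  0 < mu /\ strong_convexity_ineq mu h.

(* Convexity is taken as the case mu = 0 of the inequality above.  As a
   hypothesis it is implied by the usual (Jensen) convexity; in fact subdiff
   being the global subdifferential, every h with values in R U {+oo}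
   satisfies it. *)
Definition convex_fun (R : realType) (n : nat) (h : 'cV[R]_n -> \bar R) : Prop :=
  strong_convexity_ineq 0 h.

Definition closed_fun (R : realType) (n : nat) (h : 'cV[R]_n -> \bar R) : Prop :=
  closed [set p : 'cV[R]_n * R | (h p.1 <= p.2%:E)%E].

(* The first conjunct expresses that h takes its values in R U {+oo}. *)
Definition proper_fun (R : realType) (n : nat) (h : 'cV[R]_n -> \bar R) : Prop :=
  (forall x, h x != -oo%E) /\ edom h !=set0.

Definition is_minimizer (R : realType) (n : nat) (h : 'cV[R]_n -> \bar R)
    (x : 'cV[R]_n) : Prop :=
  forall y, (h x <= h y)%E.

Definition objective (R : realType) (n m : nat) (f : 'cV[R]_n -> \bar R)
    (g : 'cV[R]_m -> \bar R) (A : 'M[R]_(m, n)) (x : 'cV[R]_n) : \bar R :=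
  (f x + g (A *m x))%E.

Record assumption_S1 (R : realType) (n m : nat) (f : 'cV[R]_n -> \bar R)
    (g : 'cV[R]_m -> \bar R) (A : 'M[R]_(m, n)) : Prop := AssumptionS1 {
  S1_proper : proper_fun f /\ proper_fun g;
  S1_closed : closed_fun f /\ closed_fun g;
  S1_lsc : lower_semicontinuous f /\ lower_semicontinuous g;
  S1_convex : convex_fun f /\ convex_fun g;
  S1_min : exists x, is_minimizer (objective f g A) x /\
                     objective f g A x \is a fin_num;
  S1_rank : \rank A = n;
  S1_qualification :
    interior [set y - A *m x | y in edom g & x in edom f] 0
}.

Definition assumption_S2 (R : realType) (n : nat) (phi : 'cV[R]_n -> \bar R) :
    Prop :=
  exists c L : R, [/\ 0 < c, 0 < L,
    (forall x xi, subdiff phi x xi -> enorm xi <= c * (1 + enorm x)) &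
    (forall x y xix xiy, subdiff phi x xix -> subdiff phi y xiy ->
       dotv (xiy - xix) (y - x) <= L * enorm (y - x) ^+ 2)].

Definition abs_continuous_on (R : realType) (n : nat) (a b : R)
    (F : R -> 'cV[R]_n) : Prop :=
  forall eps : R, 0 < eps -> exists2 delta : R, 0 < delta &
    forall (k : nat) (u v : 'I_k -> R),
      (forall i, a <= u i /\ u i <= v i /\ v i <= b) ->
      trivIset [set: 'I_k] (fun i => `]u i, v i[%classic) ->
      \sum_(i < k) (v i - u i) < delta ->
      \sum_(i < k) enorm (F (v i) - F (u i)) < eps.

(* Solution on [0, T] of
     alpha^-1 A^T A (X'' + r / (t + 1) X') \in - d phi (X),  X 0 = x0,  X' 0 = 0
   read as a first-order system in (X, V): V is X' and a is X'' at time t. *)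
Definition is_solution (R : realType) (n m : nat) (A : 'M[R]_(m, n))
    (alpha r : R) (phi : 'cV[R]_n -> \bar R) (x0 : 'cV[R]_n) (T : R)
    (X : R -> 'cV[R]_n) : Prop :=
  exists V : R -> 'cV[R]_n,
    [/\ abs_continuous_on 0 T X, abs_continuous_on 0 T V,
        X 0 = x0, V 0 = 0 &
        {ae @lebesgue_measure R, forall t : R, 0 < t < T ->
          exists a : 'cV[R]_n,
            [/\ is_derive t (1 : R) X (V t), is_derive t (1 : R) V a &
              subdiff phi (X t)
                (- (alpha^-1 *: (A^T *m A *m (a + (r / (t + 1)) *: V t))))]}].

(* Main.v *)
(* Let s = t + 1, Y = X - x*, V = X', w = phi(X) - phi*, and <u, v>_B = <A u, A v>.
   Along a solution the energy
     s^(p-2) (alpha s^2 w + |lambda Y + s V|_B^2 / 2 - kappa |Y|_B^2)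
   is nonincreasing in two cases: p = 2, lambda = r - 1, kappa = 0 from time 0 on,
   which gives the O(1/s^2) rate; and p = lambda = 2r/3, kappa = p (p - 2) / 4
   from a fixed time t0 on when phi is strongly convex.  In the second case
   the kappa-term cancels the mixed terms <Y, V>_B, strong convexity absorbs
   the remaining |Y|_B^2, and for s >= t0 + 1 the energy dominates
   (alpha mu / 4) s^p |Y|^2; its value at t0 is bounded by the first energy. *)

Require Import Defs.
From HB Require Import structures.
From mathcomp Require Import all_boot all_order all_algebra.
From mathcomp Require Import all_classical all_reals all_analysis.
From mathcomp Require Import ring lra.

Set Implicit Arguments.
Unset Strict Implicit.
Import Order.TTheory GRing.Theory Num.Theory.
Import numFieldNormedType.Exports.
Local Open Scope classical_set_scope.
Local Open Scope ring_scope.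

(** * Absolute continuity *)

(** The inclusion yields a subgradient at [X t] only for almost every [t], and no chain rule for
    [phi (X t)] is given in advance. The [w] of the energy is therefore an absolutely continuous
    function that equals [phi(X) - phi*] at the good times and is at most [phi x0 - phi*] at time 0.
    The parameters are read off the derivative of the energy. Divided by [s^(p-2)], it contains
    [alpha s (p w - lambda <xi, Y>)], so [lambda = p] brings out the convexity gap [w - <xi, Y>].
    The coefficient of [|V|_B^2] is [s (p / 2 + lambda - r)], which then vanishes exactly for
    [p = 2 r / 3]; that of [<Y, V>_B] becomes [p (p - 2) / 2 - 2 kappa], which fixes [kappa]. For
    [p = 2], [lambda = r - 1], [kappa = 0] both coefficients vanish as well, and the factor
    [r - 1 >= 2] in front of [<xi, Y>] is harmless because [<xi, Y> >= 0]. All constants are built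
    from the first energy at time 0 and from [A], [alpha], [r], [mu], so they serve every [T] and
    every solution [X]. *)

Lemma real_induction {R : realType} (a b : R) (P : R -> Prop) : a <= b ->
  P a ->
  (forall t, a <= t <= b -> exists2 rho : R, 0 < rho &
    forall x y, a <= x -> t - rho < x -> x <= t -> t <= y -> y < t + rho ->
      y <= b -> P x -> P y) ->
  P b.
Proof.
move=> ab Pa step.
(* This is Cousin's lemma in the form of an induction: [rho] is a gauge at the tag [t], across which
   [P] is carried. Applied at [sup S], the step reaches the supremum from a nearby point of [S],
   then passes beyond it unless it equals [b]. *)
pose S := [set x | a <= x <= b /\ P x].
have Sa : S a by rewrite /S /= lexx ab.
have Sub : has_ubound S by exists b => x [/andP[]].
have supS : has_sup S by split=> //; exists a.
have ac : a <= sup S by exact: ub_le_sup.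
have cb : sup S <= b by apply: ge_sup; [exists a|move=> x [/andP[]]].
have [|rho rho0 st] := step (sup S); first by rewrite ac.
have [x [/andP[ax xb] Px] cx] := sup_adherent rho0 supS.
have xc : x <= sup S by apply: ub_le_sup => //; split=> //; rewrite ax.
have Pc : P (sup S) by apply: (st x) => //; rewrite ltrDl.
have [<-//|cltb] := eqVneq (sup S) b.
have {}cltb : sup S < b by rewrite lt_neqAle cltb.
pose y := Num.min b (sup S + rho / 2).
have cy : sup S < y by rewrite lt_min cltb ltrDl divr_gt0.
have yb : y <= b by rewrite ge_min lexx.
have : S y.
  split; first by rewrite yb (le_trans ac)// ltW.
  apply: (st x) => //; first exact: ltW.
  by rewrite gt_min; apply/orP; right; rewrite ltrD2l; lra.
by move=> /(ub_le_sup Sub); rewrite leNgt cy.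
Qed.

Lemma is_derive_epsP {R : realType} (f : R -> R) (t d : R) :
  is_derive t 1 f d <->
  (forall eps, 0 < eps -> exists2 rho : R, 0 < rho &
    forall s, `|s - t| < rho -> `|f s - f t - d * (s - t)| <= eps * `|s - t|).
Proof.
rewrite is_derive1_caratheodory; split=> [[g [fE cg gt]] eps eps0|H].
  have /cvgrPdist_le /(_ _ eps0) [rho /= rho0 Hrho] := cg.
  exists rho => // s st; rewrite fE -mulrBl normrM ler_wpM2r//.
  rewrite -gt distrC; apply: Hrho.
  by rewrite /ball_/= distrC.
exists (fun z => if z == t then d else (f z - f t) / (z - t)); split.
- move=> z; case: eqP => [->|/eqP]; first by rewrite !subrr mulr0.
  by rewrite -subr_eq0 => /divfK->.
- apply/cvgrPdist_le => eps eps0; have [rho rho0 Hrho] := H _ eps0.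
  exists rho => //= s; rewrite /ball_/= eqxx distrC => st.
  have [_|] := eqVneq s t; first by rewrite subrr normr0 ltW.
  rewrite -subr_eq0 => st0; rewrite distrC.
  rewrite -(ler_pM2r (_ : 0 < `|s - t|)) ?normr_gt0// -normrM mulrBl divfK//.
  exact: Hrho.
- by rewrite eqxx.
Qed.

Lemma is_derive_squeeze {R : realType} (f lo hi : R -> R) (t d rho : R) :
  0 < rho -> lo t = f t -> hi t = f t ->
  (forall s, `|s - t| < rho -> lo s <= f s <= hi s) ->
  is_derive t 1 lo d -> is_derive t 1 hi d -> is_derive t 1 f d.
Proof.
move=> rho0 lot hit lfh /is_derive_epsP dlo /is_derive_epsP dhi.
apply/is_derive_epsP => eps eps0.
have [r1 r10 H1] := dlo _ eps0; have [r2 r20 H2] := dhi _ eps0.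
exists (Num.min rho (Num.min r1 r2)); first by rewrite !lt_min rho0 r10.
move=> s; rewrite !lt_min => /and3P[/lfh /andP[l1 l2] /H1 + /H2].
rewrite lot hit !ler_norml => /andP[? ?] /andP[? ?].
by apply/andP; split; lra.
Qed.

Definition disjoint_intervals {R : realType} (a b : R) {k : nat}
    (u v : 'I_k -> R) : Prop :=
  (forall i, a <= u i /\ u i <= v i /\ v i <= b) /\
  trivIset [set: 'I_k] (fun i => `]u i, v i[%classic).

Definition abs_cont {R : realType} (a b : R) (h : R -> R) : Prop :=
  forall eps : R, 0 < eps -> exists2 delta : R, 0 < delta &
    forall (k : nat) (u v : 'I_k -> R), disjoint_intervals a b u v ->
      \sum_(i < k) (v i - u i) < delta ->
      \sum_(i < k) `|h (v i) - h (u i)| < eps.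

Section abs_cont_theory.
Context {R : realType} (a b : R).
Implicit Types f g h : R -> R.

Lemma abs_cont_sub c d h : a <= c -> d <= b -> abs_cont a b h -> abs_cont c d h.
Proof.
move=> ac db H eps /H[delta delta0 Hd]; exists delta => // k u v [uv tuv].
apply: Hd; split=> // i; have [? [? ?]] := uv i.
by split; [exact: le_trans ac _|split=> //; exact: le_trans db].
Qed.

(** Common source of the closure properties: Lipschitz functions, sums and products all have
    increments controlled in this way. *)
Lemma abs_cont_ctrl f g h (K : R) :
  (forall x y, a <= x -> x <= y -> y <= b ->
    `|h y - h x| <= K * (`|f y - f x| + `|g y - g x|)) ->
  abs_cont a b f -> abs_cont a b g -> abs_cont a b h.
Proof.
move=> hK acf acg eps eps0.
have K0 : 0 < `|K| + 1 by rewrite ltr_wpDl.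
have e0 : 0 < eps / (2 * (`|K| + 1)) by rewrite divr_gt0// mulr_gt0.
have [d1 d10 H1] := acf _ e0; have [d2 d20 H2] := acg _ e0.
exists (Num.min d1 d2); first by rewrite lt_min d10.
move=> k u v uv; rewrite lt_min => /andP[/(H1 _ _ _ uv) l1 /(H2 _ _ _ uv) l2].
apply: (@le_lt_trans _ _ (\sum_(i < k) (`|K| + 1) *
    (`|f (v i) - f (u i)| + `|g (v i) - g (u i)|))).
  apply: ler_sum => i _; have [uvi _] := uv; have [? [? ?]] := uvi i.
  apply: le_trans (hK _ _ _ _ _) _ => //.
  by rewrite ler_wpM2r ?addr_ge0// ler_wpDr// ler_norm.
rewrite -mulr_sumr big_split/= -ltr_pdivlMl//.
apply: lt_le_trans (ltrD l1 l2) _.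
suff -> : eps / (2 * (`|K| + 1)) + eps / (2 * (`|K| + 1)) =
  (`|K| + 1)^-1 * eps by [].
by field; rewrite gt_eqF.
Qed.

Lemma abs_cont_lip h (K : R) :
  (forall x y, a <= x -> x <= y -> y <= b -> `|h y - h x| <= K * (y - x)) ->
  abs_cont a b h.
Proof.
have acid : abs_cont a b id.
  move=> eps eps0; exists eps => // k u v [uv _].
  by under [in ltLHS]eq_bigr => i _ do
    rewrite -(@ger0_norm _ (v i - u i)) ?subr_ge0 ?(proj1 (proj2 (uv i)))//.
move=> hK; apply: (@abs_cont_ctrl id id _ `|K|) => //.
move=> x y ax xy yb; rewrite -[`|_ - _|]subr0.
apply: le_trans (_ : `|K| * `|y - x| <= _); last first.
  by rewrite ler_wpM2l// ler_wpDr.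
rewrite subr0 -normrM; exact: le_trans (hK _ _ ax xy yb) (ler_norm _).
Qed.

Lemma abs_cont_cst (c : R) : abs_cont a b (fun=> c).
Proof.
by apply: (@abs_cont_lip _ 0) => x y *; rewrite subrr normr0 mul0r.
Qed.

Lemma abs_contD f g : abs_cont a b f -> abs_cont a b g ->
  abs_cont a b (fun x => f x + g x).
Proof.
apply: (@abs_cont_ctrl _ _ _ 1) => x y *.
by rewrite mul1r opprD addrACA ler_normD.
Qed.

Lemma abs_cont_sum n (F : 'I_n -> R -> R) :
  (forall i, abs_cont a b (F i)) -> abs_cont a b (fun x => \sum_(i < n) F i x).
Proof.
elim: n F => [|n IH] F acF.
  by under eq_fun do rewrite big_ord0; exact: abs_cont_cst.
under eq_fun do rewrite big_ord_recr /=.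
exact: abs_contD (IH (fun i => F (widen_ord (leqnSn n) i)) (fun i => acF _))
  (acF ord_max).
Qed.

Lemma abs_cont_unif h : abs_cont a b h -> forall eps, 0 < eps ->
  exists2 delta : R, 0 < delta & forall x y, a <= x -> x <= y -> y <= b ->
    y - x < delta -> `|h y - h x| < eps.
Proof.
move=> ach eps /ach[delta delta0 H]; exists delta => // x y ax xy yb yx.
have := H 1%N (fun=> x) (fun=> y); rewrite !big_ord1; apply => //; split=> //.
by move=> i j _ _ _; rewrite (ord1 i) (ord1 j).
Qed.

(** Values at points closer than [delta] differ by less than 1, so carrying a bound across a short
    interval costs 1. *)
Lemma abs_cont_bounded h : a <= b -> abs_cont a b h ->
  exists2 M : R, 0 < M & forall x, a <= x <= b -> `|h x| <= M.
Proof.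
move=> ab ach; have [delta delta0 H] := abs_cont_unif ach ltr01.
pose P z := exists2 M : R, 0 < M & forall x, a <= x <= z -> `|h x| <= M.
apply: (@real_induction _ a b P) => // [|t /andP[_ tb]].
  exists (`|h a| + 1); first by rewrite ltr_wpDl.
  by move=> x /le_anti <-; rewrite lerDl.
exists (delta / 2); first by rewrite divr_gt0.
move=> x y ax tx xt ty yt yb [M M0 HM]; exists (M + 1); first by rewrite addr_gt0.
move=> z /andP[az zy]; have [zx|xz] := leP z x.
  by rewrite (le_trans (HM z _)) ?az// lerDl.
have := H x z ax (ltW xz) (le_trans zy yb).
have -> : z - x < delta by lra.
move=> /(_ isT) hzx; have := HM x; rewrite ax lexx => /(_ isT) hx.
rewrite -[h z](subrK (h x)) (le_trans (ler_normD _ _))// addrC lerD// ltW//.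
Qed.

Lemma abs_contM f g : a <= b -> abs_cont a b f -> abs_cont a b g ->
  abs_cont a b (fun x => f x * g x).
Proof.
move=> ab acf acg.
have [M M0 HM] := abs_cont_bounded ab acf.
have [N N0 HN] := abs_cont_bounded ab acg.
apply: (@abs_cont_ctrl f g _ (M + N)) => // x y ax xy yb.
have -> : f y * g y - f x * g x = f y * (g y - g x) + (f y - f x) * g x by ring.
rewrite (le_trans (ler_normD _ _))// !normrM.
have fy : `|f y| <= M by rewrite HM// yb (le_trans ax).
have gx : `|g x| <= N by rewrite HN// ax (le_trans xy).
have F0 := normr_ge0 (f y - f x); have G0 := normr_ge0 (g y - g x).
by nra.
Qed.

Lemma abs_contZ (c : R) h : a <= b -> abs_cont a b h ->
  abs_cont a b (fun x => c * h x).
Proof. by move=> ab; exact: abs_contM ab (abs_cont_cst c). Qed.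

Lemma abs_contB f g : a <= b -> abs_cont a b f -> abs_cont a b g ->
  abs_cont a b (fun x => f x - g x).
Proof.
move=> ab acf /(abs_contZ (-1) ab) /(abs_contD acf).
by under eq_fun do rewrite mulN1r.
Qed.

(** A negative value would persist on an interval to the right of the point, or to its left when the
    point is [b], and this interval meets [D]. In this way inequalities known only at good times
    reach all times. *)
Lemma abs_cont_ge0_dense h (D : set R) : abs_cont a b h ->
  (forall c d, a <= c -> c < d -> d <= b -> exists2 x, c < x < d & D x) ->
  (forall x, a < x < b -> D x -> 0 <= h x) ->
  a < b -> forall x, a <= x <= b -> 0 <= h x.
Proof.
move=> ach dense hD ab x /andP[ax xb]; rewrite leNgt; apply/negP => hx.
have [|delta delta0 H] := @abs_cont_unif _ ach (- h x); first by rewrite oppr_gt0.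
have [xltb|bx] := ltP x b.
  have [||z] := dense x (Num.min b (x + delta)) ax.
  - by rewrite lt_min xltb ltrDl.
  - by rewrite ge_min lexx.
  rewrite lt_min => /andP[xz /andP[zb zd]] /hD.
  rewrite zb (le_lt_trans ax xz) => /(_ isT) hz.
  have := H x z ax (ltW xz) (ltW zb); rewrite ltrBlDl => /(_ zd).
  by rewrite ltr_norml => /andP[_]; lra.
have {bx} xb' : x = b by apply/le_anti; rewrite xb.
have [|||z] := dense (Num.max a (b - delta)) b.
- by rewrite le_max lexx.
- by rewrite gt_max ab; lra.
- by [].
rewrite gt_max => /andP[/andP[az dz] zb] /hD.
rewrite az zb => /(_ isT) hz.
have := H z x (ltW az) _ xb; rewrite xb' => /(_ (ltW zb)).
have -> : b - z < delta by lra.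
by move=> /(_ isT); rewrite ltr_norml -xb' => /andP[]; lra.
Qed.

End abs_cont_theory.

(** * Absolutely continuous functions with nonpositive derivative *)

Lemma ae_dense {R : realType} (P : set R) (c d : R) :
  {ae @lebesgue_measure R, forall t, P t} -> c < d -> exists2 t, c < t < d & P t.
Proof.
move=> aeP cd; apply: contrapT => noP.
have [A [mA A0 PA]] := aeP.
have : (@lebesgue_measure R `]c, d[ <= @lebesgue_measure R A)%E.
  rewrite le_measure ?inE//.
  move=> t /=; rewrite in_itv/= => tcd; apply: PA => /= Pt.
  by apply: noP; exists t.
by rewrite A0 lebesgue_measure_itv /= lte_fin cd -EFinB lee_fin subr_le0 leNgt cd.
Qed.

(** Outer regularity makes [U] minus the null set small, hence [U] itself; the total length of
    disjoint intervals inside [U] is the measure of their union. This is the smallness that absolute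
    continuity asks for. *)
Lemma null_set_open_cover {R : realType} (N : set R) (delta : R) :
  (@lebesgue_measure R).-negligible N -> 0 < delta ->
  exists U : set R, [/\ open U, N `<=` U &
    forall a b k (u v : 'I_k -> R), disjoint_intervals a b u v ->
      (forall i, `]u i, v i[ `<=` U) -> \sum_(i < k) (v i - u i) < delta].
Proof.
move=> [D [mD D0 ND]] delta0.
have [|U [oU DU UD]] := lebesgue_regularity_outer mD _ delta0.
  by apply: (@le_lt_trans _ _ 0%E); [rewrite le_eqVlt; apply/orP; left; exact/eqP|exact: ltry].
have mU : measurable U by exact: measurable_realfun.open_measurable.
exists U; split=> //; first exact: subset_trans DU.
move=> a b k u v [uv tuv] uvU.
rewrite -lte_fin; apply: le_lt_trans UD.
have -> : (\sum_(i < k) (v i - u i))%:E =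
    (\sum_(i < k) @lebesgue_measure R `]u i, v i[)%E.
  rewrite -sumEFin; apply: eq_bigr => i _.
  rewrite lebesgue_measure_itv/= lte_fin; case: ltP => [_|vu].
    by rewrite EFinB.
  by have [_ [uvi _]] := uv i; rewrite (@le_anti _ _ (u i) (v i)) ?subrr// uvi.
have muU : (@lebesgue_measure R U <= @lebesgue_measure R (U `\` D))%E.
  rewrite -{1}(setUIDK U D) (le_trans (measureU2 _ _ _))//.
  - exact: measurableI.
  - exact: measurableD.
  rewrite [X in (X + _)%E](_ : _ = 0%E) ?add0e//.
  apply/eqP; rewrite -measure_le0 -D0 le_measure ?inE//; exact: measurableI.
apply: le_trans muU.
rewrite -measure_semi_additive_ord//; last exact: bigsetU_measurable.
rewrite le_measure ?inE//; first exact: bigsetU_measurable.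
by elim/big_ind : _ => // A B AU BU; rewrite subUset.
Qed.

(** Two endpoints form a null set. This bridges the open interval in the notion of solution and the
    closed one in the theorem. *)
Lemma ae_itv_closed {R : realType} (a b : R) (P : R -> Prop) :
  {ae @lebesgue_measure R, forall t, a < t < b -> P t} ->
  {ae @lebesgue_measure R, forall t, a <= t <= b -> P t}.
Proof.
have ae_neq (c : R) : {ae @lebesgue_measure R, forall t, t <> c}.
  exists [set c]; split; [exact: measurable_set1|exact: lebesgue_measure_set1|].
  by move=> t /= /contrapT ->.
have FF := ae_filter_ringOfSetsType (@lebesgue_measure R).
move=> aeP; apply: filterS3 aeP (ae_neq a) (ae_neq b) => t H /eqP ta /eqP tb.
by move=> /andP[a_t t_b]; apply: H; rewrite !lt_neqAle a_t t_b eq_sym ta tb.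
Qed.

(* A gauge argument: near a good point the increment of [h] is at most
   [eps * (y - x)]; the remaining points lie in an open set [U] of small
   measure, and the intervals used there are collected in [u], [v]. *)
Lemma abs_cont_nonincreasing {R : realType} (a b : R) (h : R -> R) : a <= b ->
  abs_cont a b h ->
  {ae @lebesgue_measure R, forall t, a < t < b ->
    exists2 d, is_derive t (1 : R) h d & d <= 0} ->
  h b <= h a.
Proof.
move=> ab ach aeh.
suff : forall eps, 0 < eps -> h b - h a <= eps * (b - a) + eps.
  move=> H; rewrite -subr_le0; apply/ler_addgt0Pl => e e0; rewrite addr0.
  have ba1 : 0 < b - a + 1 by rewrite ltr_wpDl ?subr_ge0.
  have := H (e / (b - a + 1)); rewrite divr_gt0// => /(_ isT) /le_trans; apply.
  by rewrite -{2}[e / _]mulr1 -mulrDr divfK// gt_eqF.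
move=> eps eps0; have [delta delta0 Hdelta] := ach _ eps0.
have [U [oU NU muU]] := null_set_open_cover (ae_itv_closed aeh) delta0.
(* The exceptional intervals met so far are kept in increasing order, so that appending one on the
   right is easy and their disjointness can be read off at the end. *)
pose P x := exists k (u v : nat -> R), [/\
  forall i, (i < k)%N -> [/\ a <= u i, u i <= v i & v i <= x],
  forall i j, (i < j)%N -> (j < k)%N -> v i <= u j,
  forall i, (i < k)%N -> `]u i, v i[ `<=` U &
  h x - h a <= eps * (x - a) + \sum_(i < k) `|h (v i) - h (u i)|].
have Pb : P b.
  apply: (real_induction ab).
    exists 0%N, (fun=> a), (fun=> a); split=> //.
    by rewrite !subrr mulr0 big_ord0 addr0.
  move=> t atb.
  have [[d /is_derive_epsP/(_ _ eps0)[rho rho0 Hrho] d0]|bad] :=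
      pselect (exists2 d, is_derive t (1 : R) h d & d <= 0).
    exists rho => // x y ax tx xt ty yt yb [k [u [v [uv uv' uvU hx]]]].
    exists k, u, v; split=> //.
      move=> i /uv[? ? ?]; split=> //; apply: le_trans (le_trans xt ty) => //.
    (* The expansion at [t] is used on both sides; the linear parts add up to [d * (y - x) <= 0]. *)
    have := Hrho x; have := Hrho y.
    rewrite !ltr_norml.
    have -> : - rho < y - t < rho by apply/andP; split; lra.
    have -> : - rho < x - t < rho by apply/andP; split; lra.
    move=> /(_ isT) + /(_ isT).
    rewrite (@ger0_norm _ (y - t)) ?subr_ge0// (@ler0_norm _ (x - t)) ?subr_le0//.
    rewrite !ler_norml => /andP[_ hy] /andP[hx' _].
    have : 0 <= - d * (y - x) by rewrite mulr_ge0 ?oppr_ge0 ?subr_ge0 ?(le_trans xt).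
    by lra.
  have /oU[rho /= rho0 Hrho] : U t by apply: NU => /= /(_ atb).
  exists rho => // x y ax tx xt ty yt yb [k [u [v [uv uv' uvU hx]]]].
  have xy : x <= y by exact: le_trans ty.
  exists k.+1, (fun i => if (i < k)%N then u i else x),
    (fun i => if (i < k)%N then v i else y); split.
  - move=> i _; case: ifP => // /uv[? ? vx]; split=> //; exact: le_trans xy.
  - move=> i j ij; rewrite ltnS => jk; rewrite (leq_trans ij jk).
    case: ifP => jk'; first exact: uv'.
    by have [] := uv i (leq_trans ij jk).
  - move=> i _; case: ifP => [/uvU//|_] z /=; rewrite in_itv/= => /andP[xz zy].
    by apply: Hrho; rewrite /ball_/= ltr_norml; apply/andP; split; lra.
  rewrite big_ord_recr/= ltnn.
  under eq_bigr => i _ do rewrite ltn_ord.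
  have := ler_norm (h y - h x).
  have : 0 <= eps * (y - x) by rewrite mulr_ge0 ?subr_ge0 // ltW.
  by lra.
have [k [u [v [uv uv' uvU hb]]]] := Pb.
apply: le_trans hb _; rewrite lerD2l ltW//.
have duv : @disjoint_intervals R a b k u v.
  split; first by move=> i; have [] := uv i (ltn_ord i).
  move=> i j _ _ [z [/=]]; rewrite !in_itv/= => /andP[uz zv] /andP[uz' zv'].
  apply/val_inj => /=; case: (ltngtP i j) => // ij; exfalso.
    by have := uv' _ _ ij (ltn_ord j); lra.
  by have := uv' _ _ ij (ltn_ord i); lra.
by apply: (Hdelta _ _ _ duv); apply: muU duv _ => i; exact: uvU.
Qed.

(** * Euclidean geometry and subgradients *)

(** McShane's extension, the infimum over [s] in [D] of [G s + d s t]. A pseudometric is enough, as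
    is needed for a multiple of the distance between [X s] and [X t], which may vanish at distinct
    times. *)
Lemma lipschitz_extension {R : realType} {T : Type} (D : set T) (G : T -> R)
    (d : T -> T -> R) : D !=set0 ->
  (forall x, d x x = 0) -> (forall x y, d x y = d y x) ->
  (forall x y z, d x z <= d x y + d y z) ->
  (forall s t, D s -> D t -> G s - G t <= d s t) ->
  exists2 F : T -> R, forall t, D t -> F t = G t &
    forall s t, `|F s - F t| <= d s t.
Proof.
move=> [s0 Ds0] d0 dC dT GL.
pose S t := [set G s + d t s | s in D].
have S0 t : S t !=set0 by exists (G s0 + d t s0), s0.
have Slb t : has_lbound (S t).
  exists (G s0 - d s0 t) => _ [s Ds <-].
  by have := GL _ _ Ds0 Ds; have := dT s0 t s; lra.
have FL s t : inf (S s) - inf (S t) <= d s t.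
  rewrite lerBlDr -lerBlDl; apply: lb_le_inf => // _ [z Dz <-].
  rewrite lerBlDl; apply: le_trans (ge_inf (Slb s) _) _; first by exists z.
  by have := dT s t z; lra.
exists (fun t => inf (S t)) => [t Dt|s t].
  apply/le_anti/andP; split.
    by apply: ge_inf => //; exists t => //; rewrite d0 addr0.
  apply: lb_le_inf => // _ [s Ds <-].
  by have := GL _ _ Dt Ds; lra.
by rewrite ler_norml FL andbT lerNl opprB dC FL.
Qed.

Section dotv_theory.
Context {R : realType} {n : nat}.
Implicit Types u v w : 'cV[R]_n.

Lemma dotvC u v : dotv u v = dotv v u.
Proof. by apply: eq_bigr => i _; rewrite mulrC. Qed.

Lemma dotvDl u v w : dotv (u + v) w = dotv u w + dotv v w.
Proof. by rewrite -big_split; apply: eq_bigr => i _; rewrite mxE mulrDl. Qed.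

Lemma dotvZl (c : R) u v : dotv (c *: u) v = c * dotv u v.
Proof. by rewrite mulr_sumr; apply: eq_bigr => i _; rewrite mxE mulrA. Qed.

Lemma dotvNl u v : dotv (- u) v = - dotv u v.
Proof. by rewrite -scaleN1r dotvZl mulN1r. Qed.

Lemma dotvBl u v w : dotv (u - v) w = dotv u w - dotv v w.
Proof. by rewrite dotvDl dotvNl. Qed.

Lemma dotvDr u v w : dotv u (v + w) = dotv u v + dotv u w.
Proof. by rewrite ![dotv u _]dotvC dotvDl. Qed.

Lemma dotvZr (c : R) u v : dotv u (c *: v) = c * dotv u v.
Proof. by rewrite ![dotv u _]dotvC dotvZl. Qed.

Lemma dotvNr u v : dotv u (- v) = - dotv u v.
Proof. by rewrite ![dotv u _]dotvC dotvNl. Qed.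

Lemma dotvBr u v w : dotv u (v - w) = dotv u v - dotv u w.
Proof. by rewrite dotvDr dotvNr. Qed.

Lemma dotv0l u : dotv 0 u = 0.
Proof. by rewrite -(scale0r 0) dotvZl mul0r. Qed.

Lemma dotv_ge0 u : 0 <= dotv u u.
Proof. by apply: sumr_ge0 => i _; rewrite -expr2 sqr_ge0. Qed.

Lemma enorm_ge0 u : 0 <= enorm u.
Proof. exact: sqrtr_ge0. Qed.

Lemma sqr_enorm u : enorm u ^+ 2 = dotv u u.
Proof. by rewrite sqr_sqrtr ?dotv_ge0. Qed.

Lemma enormN u : enorm (- u) = enorm u.
Proof. by rewrite /enorm dotvNl dotvNr opprK. Qed.

Lemma dotv_cauchy u v : dotv u v ^+ 2 <= dotv u u * dotv v v.
Proof.
have [v0|v0] := eqVneq (dotv v v) 0.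
  rewrite v0 mulr0; suff -> : dotv u v = 0 by rewrite expr0n.
  apply: big1 => i _; suff -> : v i 0 = 0 by rewrite mulr0.
  move/eqP: v0; rewrite psumr_eq0 => [/allP/(_ i)|j _]; last first.
    by rewrite -expr2 sqr_ge0.
  by rewrite mem_index_enum => /(_ isT)/=; rewrite mulf_eq0 orbb => /eqP.
have vgt0 : 0 < dotv v v by rewrite lt_def v0 dotv_ge0.
have := dotv_ge0 (dotv v v *: u - dotv u v *: v).
rewrite !(dotvBl, dotvBr, dotvZl, dotvZr) (dotvC v u).
rewrite [leRHS](_ : _ = dotv v v * (dotv u u * dotv v v - dotv u v ^+ 2)).
  by rewrite pmulr_rge0// subr_ge0.
by ring.
Qed.

Lemma normr_dotv u v : `|dotv u v| <= enorm u * enorm v.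
Proof.
rewrite -(@ler_pXn2r _ 2) ?nnegrE ?mulr_ge0 ?enorm_ge0//.
by rewrite exprMn !sqr_enorm real_normK ?num_real// dotv_cauchy.
Qed.

Lemma enormD u v : enorm (u + v) <= enorm u + enorm v.
Proof.
rewrite -(@ler_pXn2r _ 2) ?nnegrE ?addr_ge0 ?enorm_ge0//.
rewrite sqrrD !sqr_enorm dotvDl !dotvDr (dotvC v u).
by have := le_trans (ler_norm _) (normr_dotv u v); lra.
Qed.

Lemma enorm_dist u v : enorm (u - v) = enorm (v - u).
Proof. by rewrite -enormN opprB. Qed.

Lemma normr_coord_enorm u i : `|u i 0| <= enorm u.
Proof.
rewrite -(@ler_pXn2r _ 2) ?nnegrE ?enorm_ge0//.
rewrite real_normK ?num_real// sqr_enorm /dotv (bigD1 i)//= -expr2 lerDl.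
by apply: sumr_ge0 => j _; rewrite -expr2 sqr_ge0.
Qed.

End dotv_theory.

Lemma dotv_trmxl {R : realType} {n m} (A : 'M[R]_(m, n)) (z : 'cV[R]_m) u :
  dotv (A^T *m z) u = dotv z (A *m u).
Proof.
rewrite /dotv; under eq_bigr => i _ do rewrite mxE mulr_suml.
rewrite exchange_big; apply: eq_bigr => k _; rewrite mxE mulr_sumr.
by apply: eq_bigr => i _; rewrite mxE; ring.
Qed.

(** The witness is the squared Frobenius norm of [A]; the Cauchy inequality is applied row by
    row. *)
Lemma mulmx_enorm_bound {R : realType} {n m} (A : 'M[R]_(m, n)) :
  exists2 beta : R, 0 <= beta &
    forall u, dotv (A *m u) (A *m u) <= beta * enorm u ^+ 2.
Proof.
exists (\sum_(k < m) dotv (row k A)^T (row k A)^T) => [|u].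
  by apply: sumr_ge0 => k _; exact: dotv_ge0.
rewrite {1}/dotv mulr_suml; apply: ler_sum => k _.
have -> : (A *m u) k 0 = dotv (row k A)^T u.
  by rewrite mxE; apply: eq_bigr => i _; rewrite !mxE.
by rewrite -expr2 sqr_enorm dotv_cauchy.
Qed.

Section subdifferential.
Context {R : realType} {n : nat} {h : 'cV[R]_n -> \bar R}.
Hypothesis hNy : forall x, h x != -oo%E.
Implicit Types x y v : 'cV[R]_n.

Lemma edom_fineK x : edom h x -> (fine (h x))%:E = h x.
Proof. by move=> hx; rewrite fineK// fin_numE hNy lt_eqF. Qed.

Lemma subdiff_fine x y v : subdiff h x v -> edom h y ->
  dotv v (y - x) <= fine (h y) - fine (h x).
Proof.
move=> [hx /(_ y) H] hy; move: (H hy).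
by rewrite -(edom_fineK hx) -(edom_fineK hy) -EFinB lee_fin.
Qed.

Lemma strong_convexity_fine mu x y v : strong_convexity_ineq mu h ->
  subdiff h x v -> edom h y ->
  fine (h x) + (dotv v (y - x) + mu / 2 * enorm (y - x) ^+ 2) <= fine (h y).
Proof.
move=> sc xv hy; have hx := xv.1; have := sc _ _ _ hx hy xv.
by rewrite -(edom_fineK hx) -(edom_fineK hy) -EFinD lee_fin.
Qed.

Lemma minimizer_fine x y : is_minimizer h x -> edom h y ->
  edom h x /\ fine (h x) <= fine (h y).
Proof.
move=> hmin hy; have hx : edom h x by exact: le_lt_trans (hmin y) hy.
by split=> //; rewrite -lee_fin !edom_fineK.
Qed.

Lemma minimizer_subdiff0 x y : is_minimizer h x -> edom h y -> subdiff h x 0.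
Proof.
move=> hmin /(minimizer_fine hmin)[hx _]; split=> // z hz; rewrite dotv0l.
have [_] := minimizer_fine hmin hz.
by rewrite -(edom_fineK hx) -(edom_fineK hz) -EFinB lee_fin subr_ge0.
Qed.

End subdifferential.

(** * The objective along a curve *)

Section curves.
Context {R : realType}.
Implicit Types (a b t : R).

Definition coord_derive {n} t (P : R -> 'cV[R]_n) (dP : 'cV[R]_n) : Prop :=
  forall i, is_derive t (1 : R) (fun s => P s i 0) (dP i 0).

Definition coord_abs_cont {n} a b (P : R -> 'cV[R]_n) : Prop :=
  forall i, abs_cont a b (fun s => P s i 0).

Lemma is_derive_coord {n} t (P : R -> 'cV[R]_n) dP :
  is_derive t (1 : R) P dP -> coord_derive t P dP.
Proof.
move=> [drvP <-] i; have /derivable_mxP drv := drvP.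
by rewrite derive_mx// mxE; exact/derivableP.
Qed.

Lemma coord_derive_cst {n} t (u : 'cV[R]_n) : coord_derive t (fun=> u) 0.
Proof. by move=> i; rewrite mxE; exact: is_derive_cst. Qed.

Lemma coord_deriveB {n} t (P Q : R -> 'cV[R]_n) dP dQ :
  coord_derive t P dP -> coord_derive t Q dQ ->
  coord_derive t (fun s => P s - Q s) (dP - dQ).
Proof.
move=> HP HQ i; rewrite !mxE; under eq_fun do rewrite !mxE.
exact: (is_deriveB (HP i) (HQ i)).
Qed.

Lemma is_derive_dotv {n} t (P Q : R -> 'cV[R]_n) dP dQ :
  coord_derive t P dP -> coord_derive t Q dQ ->
  is_derive t (1 : R) (fun s => dotv (P s) (Q s))
    (dotv dP (Q t) + dotv (P t) dQ).
Proof.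
move=> HP HQ; rewrite /dotv -big_split/=.
have -> : (fun s => \sum_(i < n) P s i 0 * Q s i 0) =
    \sum_(i < n) (fun s => P s i 0 * Q s i 0).
  by apply/funext => s; rewrite fct_sumE.
apply: is_derive_sum => i; apply: is_derive_eq (is_deriveM (HP i) (HQ i)) _.
by rewrite /GRing.scale/=; ring.
Qed.

Lemma coord_derive_mulmx {n m} (A : 'M[R]_(m, n)) t P dP :
  coord_derive t P dP -> coord_derive t (fun s => A *m P s) (A *m dP).
Proof.
move=> HP k; have mulE u : (A *m u) k 0 = dotv (row k A)^T u.
  by rewrite mxE; apply: eq_bigr => i _; rewrite !mxE.
under eq_fun do rewrite mulE.
apply: is_derive_eq (is_derive_dotv (coord_derive_cst _ _) HP) _.
by rewrite mulE dotv0l add0r.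
Qed.

Lemma coord_abs_contB {n} a b (P Q : R -> 'cV[R]_n) : a <= b ->
  coord_abs_cont a b P -> coord_abs_cont a b Q ->
  coord_abs_cont a b (fun s => P s - Q s).
Proof.
move=> ab HP HQ i; under eq_fun do rewrite !mxE.
exact: (abs_contB ab (HP i) (HQ i)).
Qed.

Lemma coord_abs_cont_cst {n} a b (u : 'cV[R]_n) : coord_abs_cont a b (fun=> u).
Proof. by move=> i; exact: abs_cont_cst. Qed.

Lemma abs_cont_dotv {n} a b (P Q : R -> 'cV[R]_n) : a <= b ->
  coord_abs_cont a b P -> coord_abs_cont a b Q ->
  abs_cont a b (fun s => dotv (P s) (Q s)).
Proof.
move=> ab HP HQ; apply: (@abs_cont_sum _ a b n (fun i s => P s i 0 * Q s i 0)) => i.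
exact: (abs_contM ab (HP i) (HQ i)).
Qed.

Lemma coord_abs_cont_mulmx {n m} (A : 'M[R]_(m, n)) a b P : a <= b ->
  coord_abs_cont a b P -> coord_abs_cont a b (fun s => A *m P s).
Proof.
move=> ab HP k; under eq_fun do rewrite mxE.
apply: (@abs_cont_sum _ a b n (fun i s => A k i * P s i 0)) => i.
exact: (abs_contZ _ ab (HP i)).
Qed.

Lemma abs_cont_curve {n} a b (P : R -> 'cV[R]_n) (h : R -> R) (K : R) :
  abs_continuous_on a b P ->
  (forall x y, a <= x -> x <= y -> y <= b ->
    `|h y - h x| <= K * enorm (P y - P x)) ->
  abs_cont a b h.
Proof.
move=> acP hK eps eps0; have K0 : 0 < `|K| + 1 by rewrite ltr_wpDl.
have [delta delta0 H] := acP _ (divr_gt0 eps0 K0).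
exists delta => // k u v [uv tuv] /(H _ _ _ uv tuv); rewrite ltr_pdivlMr//.
apply: le_lt_trans; rewrite mulr_suml; apply: ler_sum => i _.
have [? [? ?]] := uv i; apply: le_trans (hK _ _ _ _ _) _ => //.
by rewrite mulrC ler_wpM2l ?enorm_ge0// ler_wpDr// ler_norm.
Qed.

Lemma abs_continuous_on_coord {n} a b (P : R -> 'cV[R]_n) :
  abs_continuous_on a b P -> coord_abs_cont a b P.
Proof.
move=> acP i; apply: (@abs_cont_curve _ _ _ P _ 1 acP) => x y _ _ _.
rewrite mul1r; apply: le_trans (normr_coord_enorm _ i).
by rewrite !mxE.
Qed.

End curves.

(* [phi (X t)] is only controlled at the times where the inclusion holds, hence
   the extension [W]; its derivative is squeezed between the subgradient
   inequality at [t] and the one at nearby times combined with the one-sided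
   Lipschitz condition. *)
Lemma value_along_curve {R : realType} {n} (phi : 'cV[R]_n -> \bar R)
    (T : R) (X : R -> 'cV[R]_n) :
  (forall x, phi x != -oo%E) -> assumption_S2 phi -> 0 < T ->
  abs_continuous_on 0 T X -> edom phi (X 0) ->
  {ae @lebesgue_measure R, forall t, 0 < t < T -> subdiff phi (X t) !=set0} ->
  exists W : R -> R, [/\ abs_cont 0 T W, W 0 <= fine (phi (X 0)) &
    forall t xi, 0 < t < T -> subdiff phi (X t) xi ->
      W t = fine (phi (X t)) /\
      forall v, coord_derive t X v -> is_derive t (1 : R) W (dotv xi v)].
Proof.
move=> phiNy [c [L [c0 L0 bnd oneL]]] T0 acX X0 aeS.
have cX := abs_continuous_on_coord acX.
have [B B0 HB] := abs_cont_bounded (ltW T0) (abs_cont_dotv (ltW T0) cX cX).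
pose D := [set t | 0 < t < T /\ subdiff phi (X t) !=set0].
have dense x y : 0 <= x -> x < y -> y <= T -> exists2 z, x < z < y & D z.
  move=> x0 xy yT; have [z /andP[xz zy] Dz] := ae_dense aeS xy.
  have zT : 0 < z < T by rewrite (le_lt_trans x0)// (lt_le_trans zy).
  by exists z; [rewrite xz|split=> //; exact: Dz].
(* [B] bounds the squared norm of [X], and a norm is at most 1 plus its square; the growth condition
   then bounds all subgradients along the curve by [M]. *)
pose M := c * (1 + (1 + B)).
have M0 : 0 <= M by rewrite mulr_ge0 ?ltW// !addr_gt0.
have subM t xi : 0 < t < T -> subdiff phi (X t) xi -> enorm xi <= M.
  move=> /andP[t0 tT] /bnd /le_trans; apply; rewrite ler_wpM2l ?(ltW c0)//.
  rewrite lerD2l; have := HB t; rewrite (ltW t0) (ltW tT) => /(_ isT).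
  rewrite ger0_norm ?dotv_ge0// -sqr_enorm.
  by have := enorm_ge0 (X t); nra.
pose G t := fine (phi (X t)).
pose d s t := M * enorm (X s - X t).
have subG t xi y : 0 < t < T -> subdiff phi (X t) xi -> edom phi y ->
    G t - fine (phi y) <= M * enorm (X t - y).
  move=> tT txi ye; have H := subdiff_fine phiNy txi ye.
  apply: (@le_trans _ _ (dotv xi (X t - y))).
    by rewrite -(opprB y) dotvNr lerNr opprB.
  apply: le_trans (ler_norm _) (le_trans (normr_dotv _ _) _).
  by rewrite ler_wpM2r ?enorm_ge0// (subM t).
have [|||||W WG Wlip] := @lipschitz_extension _ _ D G d.
- by have [z _ Dz] := dense _ _ (lexx _) T0 (lexx _); exists z.
- by move=> x; rewrite /d subrr /enorm dotv0l sqrtr0 mulr0.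
- by move=> x y; rewrite /d enorm_dist.
- move=> x y z; rewrite /d -mulrDr ler_wpM2l//.
  by rewrite -(subrKA (X y)) enormD.
- by move=> s t [sT [xi sxi]] [tT [xi' [te _]]]; exact: (subG s xi).
have acW : abs_cont 0 T W by apply: abs_cont_curve acX _ => x y _ _ _; exact: Wlip.
have Xd t xi : 0 < t < T -> subdiff phi (X t) xi -> D t.
  by move=> tT txi; split=> //; exists xi.
exists W; split=> //.
  (* Time 0 need not be a good time, so only an inequality is obtained there: the subgradient
     inequality at good times [t], tested at [X 0], is extended by continuity to [t = 0]. *)
  have ac0 : abs_cont 0 T (fun t => fine (phi (X 0)) + M * enorm (X t - X 0) - W t).
    apply: (abs_contB (ltW T0) _ acW); apply: abs_contD; first exact: abs_cont_cst.
    apply: (abs_contZ M (ltW T0)); apply: (@abs_cont_curve _ _ _ _ X _ 1 acX).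
    move=> x y _ _ _; rewrite mul1r ler_norml; apply/andP; split.
      rewrite lerNl opprB lerBlDr (enorm_dist (X y) (X x)).
      rewrite (_ : X x - X 0 = X x - X y + (X y - X 0)) ?enormD//.
      by rewrite subrKA.
    rewrite lerBlDr (_ : X y - X 0 = X y - X x + (X x - X 0)) ?enormD//.
    by rewrite subrKA.
  have := abs_cont_ge0_dense ac0 dense.
  have h t : 0 < t < T -> D t -> 0 <= fine (phi (X 0)) + M * enorm (X t - X 0) - W t.
    move=> tT [_ [xi txi]]; rewrite (WG t); last by exact: Xd txi.
    by have := subG _ _ _ tT txi X0; lra.
  move=> /(_ h T0 0); rewrite lexx (ltW T0) => /(_ isT).
  by rewrite subrr {1}/enorm dotv0l sqrtr0 mulr0 addr0 subr_ge0.
move=> t xi tT txi; have Dt := Xd _ _ tT txi; split; first exact: WG.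
move=> v Xv; have /andP[t0 tT'] := tT.
(* The two barriers differ by a term quadratic in [X s - X t], hence share their derivative at [t].
   They enclose [W] at good times, and by density at all times. *)
pose lo s := W t + dotv xi (X s - X t).
pose hi s := lo s + L * dotv (X s - X t) (X s - X t).
have cXt := coord_abs_contB (ltW T0) cX (coord_abs_cont_cst 0 T (X t)).
have aclo : abs_cont 0 T lo.
  apply: abs_contD; first exact: abs_cont_cst.
  exact: (abs_cont_dotv (ltW T0) (coord_abs_cont_cst 0 T xi) cXt).
have achi : abs_cont 0 T hi.
  apply: (abs_contD aclo); apply: (abs_contZ _ (ltW T0)).
  exact: (abs_cont_dotv (ltW T0) cXt cXt).
have Hlo := abs_cont_ge0_dense (abs_contB (ltW T0) acW aclo) dense _ T0.
have Hhi := abs_cont_ge0_dense (abs_contB (ltW T0) achi acW) dense _ T0.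
have dXt : coord_derive t (fun s => X s - X t) (v - 0).
  exact: (coord_deriveB Xv (coord_derive_cst _ _)).
have dlo : is_derive t (1 : R) lo (dotv xi v).
  apply: is_derive_eq (is_deriveD (is_derive_cst (W t) _ _)
    (is_derive_dotv (coord_derive_cst t xi) dXt)) _.
  by rewrite dotv0l !add0r subr0.
apply: (@is_derive_squeeze _ W lo hi t _ (Num.min t (T - t))) => //.
- by rewrite lt_min t0 subr_gt0.
- by rewrite /lo subrr dotvC dotv0l addr0.
- by rewrite /hi /lo subrr dotvC !dotv0l mulr0 !addr0.
- move=> s; rewrite lt_min !ltr_norml => /andP[/andP[s1 s2] /andP[s3 s4]].
  have sT : 0 <= s <= T by apply/andP; split; lra.
  apply/andP; split.
    rewrite -subr_ge0; apply: Hlo => // z zT Dz.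
    rewrite !WG// subr_ge0 /lo WG//.
    have [_ [? [ze _]]] := Dz.
    by have := subdiff_fine phiNy txi ze; rewrite /G; lra.
  rewrite -subr_ge0; apply: Hhi => // z zT Dz.
  rewrite subr_ge0 /hi /lo !WG//.
  have [_ [xi' zxi']] := Dz.
  have := subdiff_fine phiNy zxi' txi.1; rewrite -(opprB (X z)) dotvNr.
  have := oneL _ _ _ _ txi zxi';
  rewrite dotvBl sqr_enorm /G; move: (dotv xi' _) (dotv xi _) (L * _) => p q e.
  by lra.
- apply: is_derive_eq (is_deriveD dlo (is_deriveM (is_derive_cst L _ _)
    (is_derive_dotv dXt dXt))) _.
  by rewrite subrr (dotvC (v - 0)) !dotv0l addr0 /GRing.scale/= !mulr0 !addr0.
Qed.

(** * The energy *)

Lemma is_derive_addr1 {R : realType} (t : R) :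
  is_derive t (1 : R) (fun s => s + 1) 1.
Proof.
apply: is_derive_eq (is_deriveD (is_derive_id t (1 : R)) (is_derive_cst (1 : R) t (1 : R))) _.
by rewrite addr0.
Qed.

Lemma is_derive_powR_shift {R : realType} (e t : R) : 0 <= t ->
  is_derive t (1 : R) (fun s => (s + 1) `^ e) ((t + 1) `^ e * (e / (t + 1))).
Proof.
move=> t0; have s0 : 0 < t + 1 by rewrite ltr_wpDl.
have ds := is_derive_addr1 t.
apply: is_derive_eq (@is_derive1_comp _ (fun s => s `^ e) (fun s => s + 1) t _ _
  (is_derive1_powR e s0) ds) _.
by rewrite powRB ?(gt_eqF s0) ?implybT// powRr1 ?ltW//; field; rewrite gt_eqF.
Qed.

Lemma abs_cont_powR_shift {R : realType} (e T : R) : 0 <= e -> 0 <= T ->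
  abs_cont 0 T (fun s => (s + 1) `^ e).
Proof.
move=> e0 T0; apply: (@abs_cont_lip _ _ _ _ (e * (T + 1) `^ e)) => x y x0 xy yT.
have dp t : t \in `]x, y[ ->
    is_derive t (1 : R) (fun s => (s + 1) `^ e) ((t + 1) `^ e * (e / (t + 1))).
  by rewrite in_itv/= => /andP[xt _]; apply: is_derive_powR_shift; lra.
have cp : {within `[x, y], continuous (fun s => (s + 1) `^ e)}.
  apply: derivable_within_continuous => t; rewrite in_itv/= => /andP[xt _].
  by have [|] := @is_derive_powR_shift _ e t; first lra.
(* Since [z + 1 >= 1], dividing by it only decreases the derivative, so the Lipschitz constant also
   covers exponents below 1. *)
have [z] := MVT_segment xy dp cp; rewrite in_itv/= => /andP[xz zy] ->.
rewrite ger0_norm ?mulr_ge0 ?powR_ge0 ?invr_ge0 ?subr_ge0//; last by lra.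
rewrite ler_wpM2r ?subr_ge0// [leRHS]mulrC ler_pM ?powR_ge0//.
- by rewrite divr_ge0//; lra.
- by apply: ge0_ler_powR; rewrite ?nnegrE//; lra.
- by rewrite ler_pdivrMr ?ler_peMr//; lra.
Qed.

Section energy.
Context {R : realType}.
Variables (alpha r : R) (w yy yv vv : R -> R).
Implicit Types lambda kappa p t : R.

(** The square of the overview is expanded, so that differentiating the energy involves only four
    scalar functions. *)
Definition energy_core lambda kappa t :=
  alpha * (t + 1) ^+ 2 * w t +
  (lambda ^+ 2 * yy t + 2 * lambda * (t + 1) * yv t + (t + 1) ^+ 2 * vv t) / 2 -
  kappa * yy t.

Definition energy p lambda kappa t := (t + 1) `^ (p - 2) * energy_core lambda kappa t.

(* With [Y = X - x*], [V = X'], [a = X''] and the product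
   [<u, v>_B = <A u, A v>]: [yy], [yv], [vv] are [<Y, Y>_B], [<Y, V>_B],
   [<V, V>_B], while [ya], [va] are [<Y, a>_B], [<V, a>_B] and [xy], [xv] are
   [<xi, Y>], [<xi, V>] for the subgradient [xi] given by the inclusion. *)
Definition lyapunov_system t xy := exists ya va xv,
  [/\ is_derive t (1 : R) w xv, is_derive t (1 : R) yy (2 * yv t),
      is_derive t (1 : R) yv (vv t + ya), is_derive t (1 : R) vv (2 * va) &
      alpha * xy = - (ya + r / (t + 1) * yv t) /\
      alpha * xv = - (va + r / (t + 1) * vv t)].

(** This is the derivative of [energy] divided by [(t + 1) ^ (p - 2)]: the first summand comes from
    the power, the second from the core. The inclusion eliminates [ya] and [va], and the [xv] this
    introduces cancels the one from the derivative of [w]. *)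
Definition energy_rate p lambda kappa t xy :=
  (p - 2) / (t + 1) * energy_core lambda kappa t +
  (alpha * (t + 1) * (2 * w t - lambda * xy) +
   (lambda + 1 - r) * (lambda * yv t + (t + 1) * vv t) - 2 * kappa * yv t).

Lemma is_derive_energy p lambda kappa t xy : 0 <= t -> lyapunov_system t xy ->
  is_derive t (1 : R) (energy p lambda kappa)
    ((t + 1) `^ (p - 2) * energy_rate p lambda kappa t xy).
Proof.
move=> t0 [ya [va [xv [dw dyy dyv dvv [exy exv]]]]].
have s0 : t + 1 != 0 by rewrite gt_eqF// ltr_wpDl.
have ds := is_derive_addr1 t.
have ds2 := is_deriveM ds ds.
have dcore : is_derive t (1 : R) (energy_core lambda kappa)
   (alpha * (t + 1) * (2 * w t - lambda * xy) +
   (lambda + 1 - r) * (lambda * yv t + (t + 1) * vv t) - 2 * kappa * yv t).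
  have -> : energy_core lambda kappa =
     alpha *: (((fun s => s + 1) * (fun s => s + 1)) * w) +
     2^-1 *: (lambda ^+ 2 *: yy + (2 * lambda) *: ((fun s => s + 1) * yv) +
       ((fun s => s + 1) * (fun s => s + 1)) * vv) - kappa *: yy.
    apply/funext => s; rewrite /energy_core !fctE /GRing.scale/=.
    by rewrite -expr2; ring.
  apply: is_derive_eq (is_deriveB (is_deriveD (is_deriveZ alpha (is_deriveM ds2 dw))
    (is_deriveZ 2^-1 (is_deriveD (is_deriveD (is_deriveZ (lambda ^+ 2) dyy)
    (is_deriveZ (2 * lambda) (is_deriveM ds dyv))) (is_deriveM ds2 dvv))))
    (is_deriveZ kappa dyy)) _.
  rewrite /GRing.scale/= !fctE.
  have -> : ya = - (alpha * xy) - r / (t + 1) * yv t by rewrite exy; ring.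
  have -> : va = - (alpha * xv) - r / (t + 1) * vv t by rewrite exv; ring.
  by field.
apply: is_derive_eq (is_deriveM (is_derive_powR_shift (p - 2) t0) dcore) _.
by rewrite /energy_rate /GRing.scale/=; ring.
Qed.

Lemma energy_nonincreasing p lambda kappa T c d :
  2 <= p -> 0 <= c -> c <= d -> d <= T ->
  abs_cont 0 T w -> abs_cont 0 T yy -> abs_cont 0 T yv -> abs_cont 0 T vv ->
  {ae @lebesgue_measure R, forall t, c < t < d ->
    exists2 xy, lyapunov_system t xy & energy_rate p lambda kappa t xy <= 0} ->
  energy p lambda kappa d <= energy p lambda kappa c.
Proof.
move=> p2 c0 cd dT acw acyy acyv acvv aeH.
have T0 : 0 <= T by apply: le_trans (le_trans c0 cd) dT.
have acs : abs_cont 0 T (fun s : R => s + 1).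
  by apply: (@abs_cont_lip _ _ _ _ 1) => x y _ xy _; rewrite mul1r ger0_norm; lra.
have acs2 : abs_cont 0 T (fun s : R => (s + 1) ^+ 2) by exact: abs_contM.
have acE : abs_cont 0 T (energy p lambda kappa).
  apply: abs_contM => //; first by apply: abs_cont_powR_shift => //; lra.
  have acZ k h : abs_cont 0 T h -> abs_cont 0 T (fun s => k * h s).
    exact: abs_contZ.
  have -> : energy_core lambda kappa = (fun s => alpha * ((s + 1) ^+ 2 * w s) +
      2^-1 * (lambda ^+ 2 * yy s + 2 * lambda * ((s + 1) * yv s) +
        (s + 1) ^+ 2 * vv s) - kappa * yy s).
    by apply/funext => s; rewrite /energy_core; ring.
  apply: (abs_contB T0 _ (acZ _ _ acyy)).
  apply: (abs_contD (acZ _ _ (abs_contM T0 acs2 acw)) (acZ _ _ _)).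
  apply: (abs_contD _ (abs_contM T0 acs2 acvv)).
  exact: (abs_contD (acZ _ _ acyy) (acZ _ _ (abs_contM T0 acs acyv))).
apply: abs_cont_nonincreasing (abs_cont_sub c0 dT acE) _ => //.
have FF := ae_filter_ringOfSetsType (@lebesgue_measure R).
apply: filterS aeH => t H tcd; have [xy sys rate] := H tcd.
have /andP[ct _] := tcd.
exists ((t + 1) `^ (p - 2) * energy_rate p lambda kappa t xy).
  by apply: is_derive_energy sys; rewrite (le_trans c0)// ltW.
by rewrite mulr_ge0_le0 ?powR_ge0.
Qed.

End energy.

(** * Energy estimates along a solution *)

Lemma solution_lyapunov_system {R : realType} {n m : nat} (A : 'M[R]_(m, n))
    (alpha r : R) (phi : 'cV[R]_n -> \bar R) (x0 xstar : 'cV[R]_n) (phistar T : R)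
    (X : R -> 'cV[R]_n) :
  (forall x, phi x != -oo%E) -> assumption_S2 phi -> 0 < alpha -> 0 < T ->
  edom phi x0 -> is_solution A alpha r phi x0 T X ->
  exists (V : R -> 'cV[R]_n) (w : R -> R),
    let Y s := A *m (X s - xstar) in let Z s := A *m V s in
    let yy s := dotv (Y s) (Y s) in let yv s := dotv (Y s) (Z s) in
    let vv s := dotv (Z s) (Z s) in
    [/\ coord_abs_cont 0 T X /\ coord_abs_cont 0 T V, X 0 = x0 /\ V 0 = 0,
      abs_cont 0 T w, w 0 <= fine (phi x0) - phistar &
      {ae @lebesgue_measure R, forall t, 0 < t < T -> exists xi,
        [/\ subdiff phi (X t) xi, w t = fine (phi (X t)) - phistar &
          lyapunov_system alpha r w yy yv vv t (dotv xi (X t - xstar))]}].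
Proof.
move=> phiNy S2 alpha0 T0 dx0 [V [acX acV X0 V0 aeH]].
have FF := ae_filter_ringOfSetsType (@lebesgue_measure R).
have [||W [acW W0 HW]] := value_along_curve phiNy S2 T0 acX.
- by rewrite X0.
- by apply: filterS aeH => t H tT; have [a [_ _ sub]] := H tT; eexists; exact: sub.
exists V, (fun s => W s - phistar) => Y Z yy yv vv; split=> //.
- by split; exact: abs_continuous_on_coord.
- by apply: (abs_contB (ltW T0) acW); exact: abs_cont_cst.
- by rewrite lerB// -X0.
apply: filterS aeH => t H tT; have [a [dX dV sub]] := H tT.
move: sub; set xi := - _ => sub; exists xi.
have [Wt /(_ _ (is_derive_coord dX)) dW] := HW _ _ tT sub.
(* Pairing with [u] moves one factor [A] across and turns [A^T A] into the product [<., .>_B]. It is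
   used for [u = X t - xstar] and [u = V t]. *)
have dotxi u : alpha * dotv xi u =
    - (dotv (A *m u) (A *m a) + r / (t + 1) * dotv (A *m u) (Z t)).
  rewrite /xi dotvNl dotvZl -mulmxA dotv_trmxl mulmxDr -scalemxAr dotvDl dotvZl.
  by rewrite !(dotvC (A *m u)) /Z mulrN mulVKf// gt_eqF.
split=> //; first by rewrite Wt.
have dY : coord_derive t Y (A *m (V t - 0)).
  apply: coord_derive_mulmx; apply: coord_deriveB (is_derive_coord dX) _.
  exact: coord_derive_cst.
have dZ : coord_derive t Z (A *m a).
  exact/coord_derive_mulmx/is_derive_coord.
rewrite subr0 in dY.
exists (dotv (Y t) (A *m a)), (dotv (Z t) (A *m a)), (dotv xi (V t)); split.
- apply: is_derive_eq (is_deriveB dW (is_derive_cst phistar t (1 : R))) _.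
  by rewrite subr0.
- apply: is_derive_eq (is_derive_dotv dY dY) _.
  by rewrite /yv (dotvC (A *m V t)); ring.
- exact: is_derive_dotv dY dZ.
- apply: is_derive_eq (is_derive_dotv dZ dZ) _.
  by rewrite (dotvC (A *m a)); ring.
- by rewrite !dotxi.
Qed.

Lemma objective_Nyoo {R : realType} {n m : nat} (f : 'cV[R]_n -> \bar R)
    (g : 'cV[R]_m -> \bar R) (A : 'M[R]_(m, n)) :
  assumption_S1 f g A -> forall x, objective f g A x != -oo%E.
Proof.
move=> [[[fN _] [gN _]] _ _ _ _ _ _] x; rewrite /objective.
by rewrite adde_eq_ninfty negb_or fN gN.
Qed.

Section rates.
Context {R : realType} {n m : nat}.
Variables (A : 'M[R]_(m, n)) (alpha r : R) (phi : 'cV[R]_n -> \bar R).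
Variables (x0 xstar : 'cV[R]_n).
Hypotheses (phiNy : forall x, phi x != -oo%E) (S2 : assumption_S2 phi).
Hypotheses (alpha0 : 0 < alpha) (r3 : 3 <= r).
Hypotheses (dx0 : edom phi x0) (xmin : is_minimizer phi xstar).

Let phistar := fine (phi xstar).

(** An upper bound for the first energy at time 0, where the velocity vanishes. *)
Definition initial_energy := alpha * (fine (phi x0) - phistar) +
  (r - 1) ^+ 2 / 2 * dotv (A *m (x0 - xstar)) (A *m (x0 - xstar)).

Lemma initial_energy_ge0 : 0 <= initial_energy.
Proof.
have [_ min0] := minimizer_fine phiNy xmin dx0.
rewrite addr_ge0//; first by rewrite mulr_ge0 ?subr_ge0 ?(ltW alpha0).
by rewrite mulr_ge0 ?dotv_ge0// divr_ge0 ?sqr_ge0.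
Qed.

Section trajectory.
Variables (mu T : R) (X V : R -> 'cV[R]_n) (w : R -> R).
Hypotheses (mu0 : 0 <= mu) (sc : strong_convexity_ineq mu phi) (T0 : 0 < T).

Let Y s := A *m (X s - xstar).
Let Z s := A *m V s.
Let yy s := dotv (Y s) (Y s).
Let yv s := dotv (Y s) (Z s).
Let vv s := dotv (Z s) (Z s).
Let nn s := enorm (X s - xstar) ^+ 2.

Hypotheses (acX : coord_abs_cont 0 T X) (acV : coord_abs_cont 0 T V).
Hypotheses (X0 : X 0 = x0) (V0 : V 0 = 0) (acw : abs_cont 0 T w).
Hypothesis w0 : w 0 <= fine (phi x0) - phistar.
Hypothesis sys : {ae @lebesgue_measure R, forall t, 0 < t < T -> exists xi,
  [/\ subdiff phi (X t) xi, w t = fine (phi (X t)) - phistar &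
    lyapunov_system alpha r w yy yv vv t (dotv xi (X t - xstar))]}.

Let square_expand lambda s :
  lambda ^+ 2 * yy s + 2 * lambda * (s + 1) * yv s + (s + 1) ^+ 2 * vv s =
  dotv (lambda *: Y s + (s + 1) *: Z s) (lambda *: Y s + (s + 1) *: Z s).
Proof.
by rewrite dotvDl !dotvDr !dotvZl !dotvZr (dotvC (Z s) (Y s)); rewrite /yy /yv /vv; ring.
Qed.

Let square_ge0 lambda s :
  0 <= lambda ^+ 2 * yy s + 2 * lambda * (s + 1) * yv s + (s + 1) ^+ 2 * vv s.
Proof. by rewrite square_expand dotv_ge0. Qed.

Let acnn : abs_cont 0 T nn.
Proof.
have cX := coord_abs_contB (ltW T0) acX (coord_abs_cont_cst 0 T xstar).
have -> : nn = fun s => dotv (X s - xstar) (X s - xstar).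
  by apply/funext => s; exact: sqr_enorm.
exact: (abs_cont_dotv (ltW T0) cX cX).
Qed.

Let acY : coord_abs_cont 0 T Y.
Proof.
apply: (coord_abs_cont_mulmx A (ltW T0)).
exact: (coord_abs_contB (ltW T0) acX (coord_abs_cont_cst 0 T xstar)).
Qed.

Let acZ : coord_abs_cont 0 T Z.
Proof. exact: (coord_abs_cont_mulmx A (ltW T0) acV). Qed.

Let acyy : abs_cont 0 T yy. Proof. exact: (abs_cont_dotv (ltW T0) acY acY). Qed.
Let acyv : abs_cont 0 T yv. Proof. exact: (abs_cont_dotv (ltW T0) acY acZ). Qed.
Let acvv : abs_cont 0 T vv. Proof. exact: (abs_cont_dotv (ltW T0) acZ acZ). Qed.

(** The convexity inequality at [X t], tested at the minimizer. *)
Let subgradient_gap t xi : subdiff phi (X t) xi ->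
  w t = fine (phi (X t)) - phistar ->
  w t - dotv xi (X t - xstar) <= - (mu / 2 * nn t).
Proof.
move=> sub ->; have [dxs _] := minimizer_fine phiNy xmin dx0.
have := strong_convexity_fine phiNy sc sub dxs.
by rewrite -(opprB (X t)) dotvNr enormN /nn /phistar; lra.
Qed.

Let quadratic_growth t xi : subdiff phi (X t) xi ->
  w t = fine (phi (X t)) - phistar -> mu / 2 * nn t <= w t.
Proof.
move=> [dX _] ->.
have := strong_convexity_fine phiNy sc (minimizer_subdiff0 phiNy xmin dx0) dX.
by rewrite dotv0l add0r /nn /phistar; lra.
Qed.

(** The growth bound is needed at the fixed time [t0], which need not be a good time; both sides are
    continuous. *)
Lemma quadratic_growth_everywhere t : 0 <= t <= T -> mu / 2 * nn t <= w t.
Proof.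
move=> tT; rewrite -subr_ge0.
pose D := [set t | 0 < t < T -> exists xi,
  subdiff phi (X t) xi /\ w t = fine (phi (X t)) - phistar].
have FF := ae_filter_ringOfSetsType (@lebesgue_measure R).
have aeD : {ae @lebesgue_measure R, forall t, D t}.
  apply: filterS sys => s H sT; have [xi [sub ws _]] := H sT.
  by exists xi.
have acd : abs_cont 0 T (fun s => w s - mu / 2 * nn s).
  exact: (abs_contB (ltW T0) acw (abs_contZ _ (ltW T0) acnn)).
apply: (abs_cont_ge0_dense acd _ _ T0 tT) => [c d _ cd _|s sT Ds].
  exact: ae_dense aeD cd.
by rewrite subr_ge0; have [xi [sub ws]] := Ds sT; exact: quadratic_growth sub ws.
Qed.

Let nn_ge0 s : 0 <= nn s. Proof. exact: sqr_ge0. Qed.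

Lemma energy_core_le_initial t : 0 <= t <= T ->
  energy_core alpha w yy yv vv (r - 1) 0 t <= initial_energy.
Proof.
move=> /andP[t0 tT].
have powE s : energy alpha w yy yv vv 2 (r - 1) 0 s =
    energy_core alpha w yy yv vv (r - 1) 0 s.
  by rewrite /energy subrr powRr0 mul1r.
rewrite -powE; apply: (@le_trans _ _ (energy alpha w yy yv vv 2 (r - 1) 0 0)).
  apply: (@energy_nonincreasing _ alpha r w yy yv vv 2 (r - 1) 0 T) => //.
  have FF := ae_filter_ringOfSetsType (@lebesgue_measure R).
  apply: filterS sys => s H /andP[s0 st].
  have [|xi [sub ws ls]] := H; first by rewrite s0 (lt_le_trans st).
  exists (dotv xi (X s - xstar)) => //.
  have gap := subgradient_gap sub ws; have grow := quadratic_growth sub ws.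
  rewrite /energy_rate [leLHS](_ : _ =
    alpha * (s + 1) * (2 * w s - (r - 1) * dotv xi (X s - xstar))); last by ring.
  rewrite mulr_ge0_le0//.
    by rewrite mulr_ge0 ?(ltW alpha0)// addr_ge0 ?ltW.
  have : 0 <= mu / 2 * nn s by rewrite mulr_ge0 ?divr_ge0.
  move: (mu / 2 * nn s) (dotv _ _) gap grow => e xy gap grow e0.
  have xy0 : 0 <= xy by lra.
  (* [2 w - (r - 1) xy = 2 (w - xy) - (r - 3) xy]; this is where [r >= 3] enters. *)
  have : 0 <= (r - 3) * xy by rewrite mulr_ge0 ?subr_ge0.
  by lra.
rewrite powE /energy_core /initial_energy !add0r expr1n !mulr1 mul0r subr0 mul1r.
have -> : yv 0 = 0 by rewrite /yv /Z V0 mulmx0 dotvC dotv0l.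
have -> : vv 0 = 0 by rewrite /vv /Z V0 mulmx0 dotv0l.
rewrite /yy /Y X0; have := ler_wpM2l (ltW alpha0) w0.
by lra.
Qed.

Lemma value_rate t : 0 <= t <= T -> alpha * (t + 1) ^+ 2 * w t <= initial_energy.
Proof.
move=> /energy_core_le_initial; apply: le_trans.
by rewrite /energy_core mul0r subr0 lerDl divr_ge0.
Qed.

Section strongly_convex_case.
Variables (beta t0 : R).
Hypotheses (mugt0 : 0 < mu) (beta0 : 0 <= beta).
Hypothesis Abeta : forall u, dotv (A *m u) (A *m u) <= beta * enorm u ^+ 2.

Let p := 2 * r / 3.
Let kappa := (p - 2) * p / 4.

Hypotheses (t00 : 0 <= t0) (t0T : t0 <= T).
Hypothesis t0_large : p * (p - 2) * beta <= alpha * mu * (t0 + 1).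

Let p2 : 2 <= p. Proof. by rewrite /p; move: r3; lra. Qed.

Let pbeta_ge0 : 0 <= (p - 2) * beta.
Proof. by rewrite mulr_ge0// subr_ge0. Qed.

(** As [t + 1 >= 1], its square dominates [t0 + 1]. Both the decay of the second energy and its
    lower bound rest on this form. *)
Let t0_large_sqr t : t0 <= t -> p * (p - 2) * beta <= alpha * mu * (t + 1) ^+ 2.
Proof.
move=> t0t; apply: le_trans t0_large _.
rewrite ler_wpM2l ?mulr_ge0 ?(ltW alpha0)// expr2.
have t1 : 0 <= t by exact: le_trans t0t.
by nra.
Qed.

Let yy_le_nn s : yy s <= beta * nn s. Proof. exact: Abeta. Qed.

Let yy_ge0 s : 0 <= yy s. Proof. exact: dotv_ge0. Qed.

Lemma energy_rate_le0 t xy : t0 <= t -> w t - xy <= - (mu / 2 * nn t) ->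
  energy_rate alpha r w yy yv vv p p kappa t xy <= 0.
Proof.
move=> t0t gap; have s0 : 0 < t + 1 by rewrite ltr_wpDl// (le_trans t00).
(* With the chosen [p] and [kappa] the terms in [yv] and [vv] cancel. *)
rewrite [leLHS](_ : _ = p * (alpha * (t + 1) ^+ 2 * (w t - xy) +
    (p - 2) * (p + 2) / 4 * yy t) / (t + 1)); last first.
  by rewrite /energy_rate /energy_core /kappa /p; field; rewrite gt_eqF.
rewrite mulr_le0_ge0 ?invr_ge0 ?(ltW s0)// mulr_ge0_le0//; first by move: p2; lra.
have H1 : alpha * (t + 1) ^+ 2 * (w t - xy) <=
    alpha * (t + 1) ^+ 2 * - (mu / 2 * nn t).
  by rewrite ler_wpM2l// mulr_ge0 ?sqr_ge0 ?(ltW alpha0).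
have H2 : (p - 2) * (p + 2) / 4 * yy t <= (p - 2) * (p + 2) / 4 * (beta * nn t).
  by rewrite ler_wpM2l// divr_ge0// mulr_ge0//; move: p2; lra.
(* Since [p >= 2], [p + 2 <= 2 p], which brings the [yy] term under the threshold that defines
   [t0]. *)
have H3 : (p - 2) * beta * (p + 2) <= (p - 2) * beta * (2 * p).
  by rewrite ler_wpM2l//; move: p2; lra.
have H4 := t0_large_sqr t0t.
have : 0 <= (alpha * mu * (t + 1) ^+ 2 * 2 - (p - 2) * beta * (p + 2)) * nn t.
  by rewrite mulr_ge0//; lra.
by lra.
Qed.

Lemma energy_initial_bound : energy alpha w yy yv vv p p kappa t0 <=
  (t0 + 1) `^ (p - 2) * (3 * initial_energy +
    (r - 1 - p) ^+ 2 * beta * (2 * initial_energy / (alpha * mu))).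
Proof.
have t0T' : 0 <= t0 <= T by rewrite t00.
rewrite ler_wpM2l ?powR_ge0//.
have E0 := energy_core_le_initial t0T'; have w_rate := value_rate t0T'.
have grow := quadratic_growth_everywhere t0T'.
have amu0 : 0 < alpha * mu by rewrite mulr_gt0.
(* The value rate at [t0] is combined with quadratic growth; [(t0 + 1)^2 >= 1] is dropped. *)
have nn_le : nn t0 <= 2 * initial_energy / (alpha * mu).
  rewrite ler_pdivlMr//.
  have w_ge0 : 0 <= w t0 by apply: le_trans grow; rewrite mulr_ge0 ?divr_ge0.
  have s2 : alpha * w t0 <= alpha * (t0 + 1) ^+ 2 * w t0.
    rewrite -mulrA ler_wpM2l ?(ltW alpha0)// ler_peMl// expr2.
    by have := t00; nra.
  by have := ler_wpM2l (ltW alpha0) grow; lra.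
have yy_le := le_trans (yy_le_nn t0) (ler_wpM2l beta0 nn_le).
have {}yy_le := ler_wpM2l (sqr_ge0 (r - 1 - p)) yy_le.
have kyy : 0 <= kappa * yy t0.
  by rewrite mulr_ge0// /kappa divr_ge0// mulr_ge0//; move: p2; lra.
(* Parallelogram law: [p] and [2 (r - 1) - p] are symmetric about [r - 1], so [|p Y + s V|_B^2 / 2]
   is at most [|(r - 1) Y + s V|_B^2 + (r - 1 - p)^2 |Y|_B^2]. The first square costs two initial
   energies and [alpha s^2 w] a third. *)
have sq1 := square_ge0 (2 * (r - 1) - p) t0; have sq2 := square_ge0 (r - 1) t0.
have w_ge0 : 0 <= alpha * (t0 + 1) ^+ 2 * w t0.
  rewrite mulr_ge0//; first by rewrite mulr_ge0 ?sqr_ge0 ?(ltW alpha0).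
  by apply: le_trans grow; rewrite mulr_ge0 ?divr_ge0.
by move: E0; rewrite /energy_core; lra.
Qed.

(** Quadratic growth contributes [alpha mu s^2 / 2] times [nn], of which the [kappa] term consumes
    at most half once [t >= t0]. *)
Lemma energy_lower_bound t : t0 <= t -> mu / 2 * nn t <= w t ->
  alpha * mu / 4 * (t + 1) `^ p * nn t <= energy alpha w yy yv vv p p kappa t.
Proof.
move=> t0t grow; have s0 : 0 < t + 1 by rewrite ltr_wpDl// (le_trans t00).
have -> : (t + 1) `^ p = (t + 1) `^ (p - 2) * (t + 1) ^+ 2.
  rewrite -(@powR_mulrn _ _ 2) ?(ltW s0)// -powRD ?subrK//.
  by rewrite (gt_eqF s0) implybT.
rewrite (_ : _ * nn t = (t + 1) `^ (p - 2) *
  (alpha * mu / 4 * (t + 1) ^+ 2 * nn t)); last by ring.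
rewrite ler_wpM2l ?powR_ge0// /energy_core.
have H1 : alpha * (t + 1) ^+ 2 * (mu / 2 * nn t) <= alpha * (t + 1) ^+ 2 * w t.
  by rewrite ler_wpM2l// mulr_ge0 ?sqr_ge0 ?(ltW alpha0).
have H2 : kappa * yy t <= kappa * (beta * nn t).
  by rewrite ler_wpM2l// /kappa divr_ge0// mulr_ge0//; move: p2; lra.
have H3 : 0 <= (alpha * mu * (t + 1) ^+ 2 - p * (p - 2) * beta) * nn t.
  by rewrite mulr_ge0// subr_ge0 t0_large_sqr.
have := square_ge0 p t; move: H2; rewrite /kappa.
by lra.
Qed.

Lemma distance_rate : {ae @lebesgue_measure R, forall t, 0 < t < T -> t0 <= t ->
  nn t <= 4 * ((t0 + 1) `^ (p - 2) * (3 * initial_energy +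
    (r - 1 - p) ^+ 2 * beta * (2 * initial_energy / (alpha * mu)))) /
    (alpha * mu * (t + 1) `^ p)}.
Proof.
have FF := ae_filter_ringOfSetsType (@lebesgue_measure R).
apply: filterS sys => t H tT t0t; have [xi [sub wt _]] := H tT.
have /andP[_ /ltW t_le] := tT.
have lower := energy_lower_bound t0t (quadratic_growth sub wt).
have mono : energy alpha w yy yv vv p p kappa t <=
    energy alpha w yy yv vv p p kappa t0.
  apply: (@energy_nonincreasing _ alpha r w yy yv vv p p kappa T) => //.
  apply: filterS sys => s Hs /andP[t0s st].
  have [|xi' [sub' ws ls]] := Hs.
    by rewrite (le_lt_trans t00 t0s) (lt_le_trans st).
  exists (dotv xi' (X s - xstar)) => //.
  by apply: energy_rate_le0 (ltW t0s) _; exact: subgradient_gap.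
have st0 : 0 < (t + 1) `^ p by rewrite powR_gt0// ltr_wpDl// (le_trans t00).
rewrite ler_pdivlMr ?mulr_gt0//.
by have := le_trans lower (le_trans mono energy_initial_bound); lra.
Qed.

End strongly_convex_case.

End trajectory.
End rates.

Unset Implicit Arguments.
Set Strict Implicit.

Theorem proposition13 (R : realType) (n m : nat)
    (f : 'cV[R]_n -> \bar R) (g : 'cV[R]_m -> \bar R) (A : 'M[R]_(m, n))
    (alpha r : R) (x0 xstar : 'cV[R]_n)
    (hS1 : assumption_S1 f g A)
    (hS2 : assumption_S2 (objective f g A))
    (halpha : 0 < alpha) (hr : 3 <= r)
    (hx0 : edom (objective f g A) x0)
    (hxstar : is_minimizer (objective f g A) xstar) :
  (convex_fun (objective f g A) ->
     exists C : R, 0 < C /\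
       forall (T : R) (X : R -> 'cV[R]_n), 0 <= T ->
         is_solution A alpha r (objective f g A) x0 T X ->
         {ae @lebesgue_measure R, forall t : R, 0 <= t <= T ->
           (objective f g A (X t) - objective f g A xstar
              <= (C / (t + 1) ^+ 2)%:E)%E})
  /\
  (forall mu : R, strongly_convex mu (objective f g A) ->
     exists t0 C : R, 0 < t0 /\ 0 <= C /\
       forall (T : R) (X : R -> 'cV[R]_n), 0 <= T ->
         is_solution A alpha r (objective f g A) x0 T X ->
         {ae @lebesgue_measure R, forall t : R, 0 <= t <= T ->
           Num.max 0 t0 <= t ->
           enorm (X t - xstar) ^+ 2
             <= 4 * C / (alpha * mu * (t + 1) `^ (2 * r / 3))}).
Proof.
have phiNy := objective_Nyoo hS1.
have FF := ae_filter_ringOfSetsType (@lebesgue_measure R).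
set phi := objective f g A in hS2 hx0 hxstar phiNy *.
have [dxs _] := minimizer_fine phiNy hxstar hx0.
pose E := initial_energy A alpha r phi x0 xstar.
have E0 : 0 <= E by exact: initial_energy_ge0.
split=> [sc0|mu [mu0 sc]].
  (* The added 1 makes the constant positive even when [E = 0]. *)
  exists (E / alpha + 1); split; first by rewrite ltr_wpDl ?divr_ge0// ltW.
  move=> T X _ solX; apply: ae_itv_closed.
  have [T0|T0] := ltP 0 T; last first.
    by apply: aeW => t /andP[t0 /(lt_trans t0)]; rewrite ltNge T0.
  have [V [w [[acX acV] [X0 V0] acw w0 sys]]] := solution_lyapunov_system xstar
    (fine (phi xstar)) phiNy hS2 halpha T0 hx0 solX.
  apply: filterS (sys) => t H tT; have [xi [[dX _] wt _]] := H tT.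
  have s2 : 0 < (t + 1) ^+ 2 by rewrite exprn_gt0// ltr_wpDl// ltW//; case/andP: tT.
  have tT' : 0 <= t <= T by case/andP: tT => t0 tT; rewrite !ltW.
  have := value_rate phiNy halpha hr hx0 hxstar (lexx 0) sc0 T0 acX acV X0 V0 acw
    w0 sys tT'.
  rewrite -/E wt -(edom_fineK phiNy dX) -(edom_fineK phiNy dxs) -EFinB lee_fin.
  rewrite ler_pdivlMr// => rate.
  apply: (@le_trans _ _ (E / alpha)); last by rewrite lerDl.
  by rewrite ler_pdivlMr//; lra.
have [beta beta0 Abeta] := mulmx_enorm_bound A.
pose p := 2 * r / 3.
(* The fraction supplies the threshold [t0_large]; the 1 makes [t0] positive, so that [t0 <= T]
   forces [0 < T]. *)
pose t0 := 1 + p * (p - 2) * beta / (alpha * mu).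
have amu0 : 0 < alpha * mu by rewrite mulr_gt0.
have t01 : 1 <= t0.
  by rewrite lerDl divr_ge0 ?(ltW amu0)// !mulr_ge0// /p; lra.
exists t0, ((t0 + 1) `^ (p - 2) *
  (3 * E + (r - 1 - p) ^+ 2 * beta * (2 * E / (alpha * mu)))).
split; first by lra.
split.
  have E2 : 0 <= 2 * E / (alpha * mu) by rewrite divr_ge0 ?(ltW amu0)// mulr_ge0.
  rewrite mulr_ge0 ?powR_ge0// addr_ge0//; first by rewrite mulr_ge0.
  by rewrite mulr_ge0// mulr_ge0 ?sqr_ge0.
move=> T X _ solX; apply: ae_itv_closed.
(* If [T < t0], no time of the interval is concerned. *)
have [t0T|t0T] := leP t0 T; last first.
  apply: aeW => t /andP[_ tT]; rewrite ge_max => /andP[_ t0t].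
  by have := le_lt_trans t0t tT; rewrite ltNge ltW.
have T0 : 0 < T by lra.
have [V [w [[acX acV] [X0 V0] acw w0 sys]]] := solution_lyapunov_system xstar
  (fine (phi xstar)) phiNy hS2 halpha T0 hx0 solX.
have t00 : 0 <= t0 by lra.
have t0_large : p * (p - 2) * beta <= alpha * mu * (t0 + 1).
  rewrite [leRHS](_ : _ = 2 * (alpha * mu) + p * (p - 2) * beta).
    by rewrite lerDr mulr_ge0 ?(ltW amu0).
  by rewrite /t0; field; rewrite !gt_eqF.
have := distance_rate phiNy halpha hr hx0 hxstar (ltW mu0) sc T0 acX acV X0 V0
  acw w0 sys mu0 beta0 Abeta t00 t0T t0_large.
apply: filterS => t H tT; rewrite ge_max => /andP[_ t0t].
exact: H.
Qed.
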